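(* Let $N>2$ be an integer, let $R>0$, and let $B\subset\mathbb{R}^N$ be the ball of radius $R$ centered at the origin. Let $p,q>1$ and let $\delta>0$, $\mu>0$ satisfy $\delta\mu-(p-1)(q-1)>0$. Consider the Dirichlet problem $$(S_R)\qquad -\Delta_p u=v^\delta,\ v>0\ \text{in } B,\qquad -\Delta_q v=u^\mu,\ u>0\ \text{in } B,\qquad u=v=0\ \text{on }\partial B .$$ (1) If $2\le p<N$, $2\le q<N$, and $$\frac{1}{\delta+1}+\frac{1}{\mu+1}\le\frac{N-\overline{m}}{N(\overline{m}-1)},\qquad \overline{m}=\max\{p,q\},$$ then $(S_R)$ has no (radially symmetric) solutions, regular or not. (2) If $\frac{N}{N-1}<p\le 2$, $\frac{N}{N-1}<q\le 2$, and $$\frac{1}{\delta+1}+\frac{1}{\mu+1}\le\frac{N(\underline{m}-1)-\underline{m}}{N(\underline{m}-1)},\qquad \underline{m}=\min\{p,q\},$$ then $(S_R)$ has no (radially symmetric) solutions, regular or not.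
   Context: For $m>1$, $\Delta_m u=\operatorname{div}(|\nabla u|^{m-2}\nabla u)$ is the $m$-Laplacian. Solutions are understood to be radially symmetric; writing again $u,v$ for the solutions as functions of $r=|x|$, a solution of $(S_R)$ (regular or not) is a pair $(u,v)\in (C^2(0,R])^2$ with $u>0$, $v>0$ on $(0,R)$, $u(R)=v(R)=0$, and $$-(r^{N-1}|u'(r)|^{p-2}u'(r))'=r^{N-1}v(r)^\delta,\qquad -(r^{N-1}|v'(r)|^{q-2}v'(r))'=r^{N-1}u(r)^\mu,\qquad 0<r<R ,$$ with no condition imposed at $r=0$. The solution is called regular if in addition $(u,v)\in (C^1[0,R])^2$ and $u'(0)=v'(0)=0$. *)

(* Defs.v *)
(* Real numbers of the Rocq standard library (Stdlib.Reals). *)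
From Stdlib Require Import Reals.
Open Scope R_scope.

(* The interval (0, rad]. *)
Definition half_open_interval (rad : R) : R -> Prop := fun r => 0 < r <= rad.

(* [f] is of class C^2 on [D], with derivatives [f'] and [f'']. [D_in] is the
   derivative relative to [D], hence one-sided at an end point that belongs
   to [D]. *)
Definition is_C2_on (D : R -> Prop) (f f' f'' : R -> R) : Prop :=
  forall x, D x -> D_in f f' D x /\ D_in f' f'' D x /\ continue_in f'' D x.

(* |s|^(m-2) s. The junk value [Rpower 0 (m - 2) = 1] is harmless: it is
   multiplied by s = 0, and 0 is the correct value since m > 1. *)
Definition plap_flux (m s : R) : R := Rpower (Rabs s) (m - 2) * s.

(* -(r^(N-1) |w'|^(m-2) w')' = r^(N-1) z^a on (0, rad): the equation
   - Delta_m w = z^a for radial functions. [Rpower (z r) a] is the usual power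
   only where z > 0, which [is_radial_solution] requires on (0, rad). *)
Definition radial_equation (N : nat) (m : R) (w' z : R -> R) (a rad : R) : Prop :=
  forall r, 0 < r < rad ->
    derivable_pt_lim (fun s => - (s ^ (N - 1) * plap_flux m (w' s))) r
      (r ^ (N - 1) * Rpower (z r) a).

(* Nothing is required at r = 0, so regular and singular solutions are both
   included; the values of u and v outside (0, rad] are irrelevant. *)
Definition is_radial_solution
    (N : nat) (p q delta mu rad : R) (u v : R -> R) : Prop :=
  exists u' u'' v' v'' : R -> R,
    is_C2_on (half_open_interval rad) u u' u'' /\
    is_C2_on (half_open_interval rad) v v' v'' /\
    (forall r, 0 < r < rad -> 0 < u r /\ 0 < v r) /\
    u rad = 0 /\ v rad = 0 /\
    radial_equation N p u' v delta rad /\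
    radial_equation N q v' u mu rad.

(* Main.v *)
Require Import Defs.
From Stdlib Require Import Reals Lra Lia.
Open Scope R_scope.

(** The proof is a Pohozaev argument in the variables X = - r u'/u,
    Y = - r v'/v, Z = r^N v^delta / U and W = r^N u^mu / V, where
    U = r^(N-1) |u'|^(p-1) and V = r^(N-1) |v'|^(q-1) are the fluxes. Write
    P = p - 1 and Q = q - 1.

    A positive solution is decreasing: U increases, and if it were negative
    near the origin then u would tend to -oo there, because p <= N
    ([flux_positive]). Hence X, Y, Z, W are positive, and they satisfy a
    quadratic autonomous system in ln r. Since v decreases, Z <= N, and
    likewise W <= N ([growth_le_dim]).

    With the weight H = r^(-theta) U^a V^b, the energy
      E = H (1 - (N - aZ)/((delta+1) Y) - (N - bW)/((mu+1) X))
    satisfies E <= H as soon as 0 < a, b <= 1. At r = R the functions u, v vanish and the fluxes do not,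
    so X and Y tend to +oo and E > 0 near R. For suitable a, b <= 1 and
    theta >= N/(delta+1) + N/(mu+1), the bounds on Z and W make E nonincreasing
    ([energy_rate_nonpos]). When p, q >= 2 one takes a = 1/P, b = 1/Q and
    theta = (N-m)/(m-1), m = max(p,q); when p, q <= 2 one takes a = b = 1 and
    theta = N - m/(m-1), m = min(p,q). In both cases the hypothesis of the
    theorem is the lower bound required of theta. It follows that
    H >= E >= c > 0 near the origin.

    On the other hand, the superlinearity delta mu > P Q gives the a priori
    bounds u = O(r^(-gam)), v = O(r^(-xi)) at the origin, and matching bounds
    on the fluxes ([scaled_logs_upper]), with gam and xi the exponents of the
    self-similar solution. These bounds make H tend to 0 unless p = q = 2 and
    equality holds in the hypothesis ([exponent_gap_degenerate],
    [exponent_gap_singular]).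

    In the remaining case the system is Hamiltonian in ln r and E is a positive
    constant. The lower bound on H then shows that r^gam u and r^xi v lie
    between positive constants, and a second functional, linear in X and Y with
    a weight that is a product of powers of r^gam u and r^xi v, is bounded below
    while its derivative in ln r is at least a positive constant
    ([no_flux_system_critical]): this is impossible as r tends to 0. *)

(** * The Euler operator *)

(** The relation r f'(r) = l. The operator r d/dr is the derivative in ln r, in
    which the system below is autonomous. *)
Definition euler (f : R -> R) (r l : R) : Prop := derivable_pt_lim f r (l / r).

Lemma euler_plus f g r l m :
  euler f r l -> euler g r m -> euler (fun s => f s + g s) r (l + m).
Proof.
  unfold euler; intros Hf Hg.
  replace ((l + m) / r) with (l / r + m / r) by (unfold Rdiv; ring).
  exact (derivable_pt_lim_plus f g r _ _ Hf Hg).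
Qed.

Lemma euler_scal c f r l : euler f r l -> euler (fun s => c * f s) r (c * l).
Proof.
  unfold euler; intros Hf.
  replace (c * l / r) with (c * (l / r)) by (unfold Rdiv; ring).
  exact (derivable_pt_lim_scal f c r _ Hf).
Qed.

Lemma euler_mult f g r l m :
  euler f r l -> euler g r m -> euler (fun s => f s * g s) r (l * g r + f r * m).
Proof.
  unfold euler; intros Hf Hg.
  replace ((l * g r + f r * m) / r) with (l / r * g r + f r * (m / r))
    by (unfold Rdiv; ring).
  exact (derivable_pt_lim_mult f g r _ _ Hf Hg).
Qed.

Lemma euler_const c r : euler (fun _ => c) r 0.
Proof.
  unfold euler; replace (0 / r) with 0 by (unfold Rdiv; ring).
  exact (derivable_pt_lim_const c r).
Qed.

Lemma euler_ln r : 0 < r -> euler ln r 1.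
Proof.
  intros Hr; unfold euler; replace (1 / r) with (/ r) by (field; lra).
  exact (derivable_pt_lim_ln r Hr).
Qed.

Lemma euler_exp f r l :
  euler f r l -> euler (fun s => exp (f s)) r (exp (f r) * l).
Proof.
  unfold euler; intros Hf.
  replace (exp (f r) * l / r) with (exp (f r) * (l / r)) by (unfold Rdiv; ring).
  exact (derivable_pt_lim_comp f exp r _ _ Hf (derivable_pt_lim_exp (f r))).
Qed.

Lemma euler_ln_comp f r l :
  0 < f r -> euler f r l -> euler (fun s => ln (f s)) r (l / f r).
Proof.
  unfold euler; intros Hpos Hf.
  replace (l / f r / r) with (/ f r * (l / r)) by (unfold Rdiv; ring).
  exact (derivable_pt_lim_comp f ln r _ _ Hf (derivable_pt_lim_ln (f r) Hpos)).
Qed.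

Lemma euler_div f g r l m :
  g r <> 0 -> euler f r l -> euler g r m ->
  euler (fun s => f s / g s) r ((l * g r - m * f r) / (g r * g r)).
Proof.
  unfold euler; intros Hg0 Hf Hg.
  replace ((l * g r - m * f r) / (g r * g r) / r)
    with ((l / r * g r - m / r * f r) / Rsqr (g r))
    by (unfold Rdiv, Rsqr; ring).
  exact (derivable_pt_lim_div f g r _ _ Hf Hg Hg0).
Qed.

Lemma euler_ext f g r l : (forall s, f s = g s) -> euler f r l -> euler g r l.
Proof. intros Hfg; exact (derivable_pt_lim_ext f g r (l / r) Hfg). Qed.

Lemma euler_value f r l m : euler f r l -> l = m -> euler f r m.
Proof. intros H <-; exact H. Qed.

Lemma euler_nondecreasing f g s t :
  0 < s -> s <= t ->
  (forall r, s <= r <= t -> euler f r (g r)) ->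
  (forall r, s < r < t -> 0 <= g r) ->
  f s <= f t.
Proof.
  intros Hs [Hst | <-] Hf Hg; [| lra].
  destruct (MVT_cor2 f (fun r => g r / r) s t Hst) as [c [Hc1 Hc2]].
  { intros c Hc; apply Hf; lra. }
  assert (0 <= g c / c).
  { apply Rmult_le_pos; [apply Hg; lra |].
    left; apply Rinv_0_lt_compat; lra. }
  assert (0 <= g c / c * (t - s)) by (apply Rmult_le_pos; lra).
  lra.
Qed.

Lemma euler_nonincreasing f g s t :
  0 < s -> s <= t ->
  (forall r, s <= r <= t -> euler f r (g r)) ->
  (forall r, s < r < t -> g r <= 0) ->
  f t <= f s.
Proof.
  intros Hs Hst Hf Hg.
  assert (H : -1 * f s <= -1 * f t); [| lra].
  apply (euler_nondecreasing (fun r => -1 * f r) (fun r => -1 * g r)); auto.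
  - intros r Hr; apply euler_scal; auto.
  - intros r Hr; specialize (Hg r Hr); lra.
Qed.

Lemma exp_le x y : x <= y -> exp x <= exp y.
Proof. intros [H | ->]; [left; apply exp_increasing; exact H | lra]. Qed.

Lemma ln_le x y : 0 < x -> x <= y -> ln x <= ln y.
Proof. intros Hx [H | ->]; [left; apply ln_increasing; assumption | lra]. Qed.

Lemma exists_small_ln rad B : 0 < rad -> exists r, 0 < r < rad /\ ln r < B.
Proof.
  intros Hrad; exists (exp (Rmin B (ln rad) - 1)).
  pose proof (Rmin_l B (ln rad)); pose proof (Rmin_r B (ln rad)).
  rewrite ln_exp; repeat split; [apply exp_pos | | lra].
  rewrite <- (exp_ln rad Hrad) at 2; apply exp_increasing; lra.
Qed.

(** A function with r f' >= c > 0 grows like c ln r, so it tends to -oo at 0. *)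
Lemma euler_pos_unbounded f g rad c B :
  0 < rad -> 0 < c ->
  (forall r, 0 < r < rad -> euler f r (g r)) ->
  (forall r, 0 < r < rad -> c <= g r) ->
  exists r, 0 < r < rad /\ f r < B.
Proof.
  intros Hrad Hc Hf Hg.
  set (t := rad / 2).
  destruct (exists_small_ln t (ln t + (B - f t) / c)) as [r [Hr Hln]];
    [unfold t; lra |].
  exists r; split; [unfold t in Hr; lra |].
  assert (H : f r + (- c) * ln r <= f t + (- c) * ln t).
  { apply (euler_nondecreasing (fun s => f s + (- c) * ln s)
             (fun s => g s + (- c) * 1)); unfold t in *; try lra.
    - intros s Hs; apply euler_plus; [apply Hf; lra | apply euler_scal, euler_ln; lra].
    - intros s Hs; assert (c <= g s) by (apply Hg; lra); lra. }
  assert (c * (ln r - ln t) < B - f t).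
  { replace (B - f t) with (c * ((B - f t) / c)) by (field; lra).
    apply Rmult_lt_compat_l; lra. }
  lra.
Qed.

(** * The first-order system of the fluxes *)

(** With U = r^(N-1) |u'|^P and V = r^(N-1) |v'|^Q, where P = p - 1 and
    Q = q - 1, a decreasing radial solution is a solution of this first-order
    system. Powers are written through exp and ln, which makes the dimension a
    real number. The exponents and functions come in pairs that the exchange of
    the two equations swaps. *)
Record flux_system (N P Q delta mu rad : R) (u v U V : R -> R) : Prop := {
  fs_u_pos : forall r, 0 < r < rad -> 0 < u r;
  fs_v_pos : forall r, 0 < r < rad -> 0 < v r;
  fs_U_pos : forall r, 0 < r < rad -> 0 < U r;
  fs_V_pos : forall r, 0 < r < rad -> 0 < V r;
  fs_u_deriv : forall r, 0 < r < rad ->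
    derivable_pt_lim u r (- exp ((ln (U r) - (N - 1) * ln r) / P));
  fs_v_deriv : forall r, 0 < r < rad ->
    derivable_pt_lim v r (- exp ((ln (V r) - (N - 1) * ln r) / Q));
  fs_U_deriv : forall r, 0 < r < rad ->
    derivable_pt_lim U r (exp ((N - 1) * ln r + delta * ln (v r)));
  fs_V_deriv : forall r, 0 < r < rad ->
    derivable_pt_lim V r (exp ((N - 1) * ln r + mu * ln (u r)));
  fs_u_vanish : forall eps, 0 < eps ->
    exists s, 0 < s < rad /\ forall r, s < r < rad -> u r < eps;
  fs_v_vanish : forall eps, 0 < eps ->
    exists s, 0 < s < rad /\ forall r, s < r < rad -> v r < eps
}.

Arguments fs_u_pos {N P Q delta mu rad u v U V}.
Arguments fs_v_pos {N P Q delta mu rad u v U V}.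
Arguments fs_U_pos {N P Q delta mu rad u v U V}.
Arguments fs_V_pos {N P Q delta mu rad u v U V}.
Arguments fs_u_deriv {N P Q delta mu rad u v U V}.
Arguments fs_v_deriv {N P Q delta mu rad u v U V}.
Arguments fs_U_deriv {N P Q delta mu rad u v U V}.
Arguments fs_V_deriv {N P Q delta mu rad u v U V}.
Arguments fs_u_vanish {N P Q delta mu rad u v U V}.
Arguments fs_v_vanish {N P Q delta mu rad u v U V}.

Lemma flux_system_swap {N P Q delta mu rad u v U V} :
  flux_system N P Q delta mu rad u v U V -> flux_system N Q P mu delta rad v u V U.
Proof. intros []; constructor; assumption. Qed.

(** The decay rate (N - p)/(p - 1) of the fundamental solution of the
    p-Laplacian, with P = p - 1. *)
Definition decay (N P : R) : R := (N - 1) / P - 1.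

(** -r u'/u, the variable X of the Emden-Fowler dynamical system, and Y for the
    other component. *)
Definition slope (N P : R) (u U : R -> R) (r : R) : R :=
  exp (ln (U r) / P - decay N P * ln r - ln (u r)).

(** r U'/U = r^N v^delta / U, the variable Z of the dynamical system, and W for
    the other component. *)
Definition growth (N delta : R) (v U : R -> R) (r : R) : R :=
  exp (N * ln r + delta * ln (v r) - ln (U r)).

Lemma slope_pos N P u U r : 0 < slope N P u U r.
Proof. apply exp_pos. Qed.

Lemma growth_pos N delta v U r : 0 < growth N delta v U r.
Proof. apply exp_pos. Qed.

Section Flow.

Context {N P Q delta mu rad : R} {u v U V : R -> R}.
Context (hP : 0 < P) (sys : flux_system N P Q delta mu rad u v U V).

Let u_pos := fs_u_pos sys.
Let U_pos := fs_U_pos sys.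

Lemma slope_mult_u r :
  0 < r < rad -> slope N P u U r * u r = exp ((ln (U r) - (N - 1) * ln r) / P) * r.
Proof.
  intros Hr; pose proof (u_pos r Hr) as Hu; unfold slope.
  replace ((ln (U r) - (N - 1) * ln r) / P)
    with (ln (U r) / P - decay N P * ln r - ln (u r) + (ln (u r) + - ln r))
    by (unfold decay; field; lra).
  rewrite !(exp_plus _ (_ + _)), (exp_plus _ (- _)), exp_Ropp, !exp_ln by lra.
  field; lra.
Qed.

Lemma growth_mult_U r :
  0 < r < rad -> growth N delta v U r * U r = exp (N * ln r + delta * ln (v r)).
Proof.
  intros Hr; pose proof (U_pos r Hr) as HU; unfold growth.
  rewrite <- (exp_ln (U r) HU) at 2.
  rewrite <- !exp_plus; f_equal; ring.
Qed.

Lemma euler_u r : 0 < r < rad -> euler u r (- (slope N P u U r * u r)).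
Proof.
  intros Hr; unfold euler; rewrite slope_mult_u by exact Hr.
  replace (- (_ * r) / r) with (- exp ((ln (U r) - (N - 1) * ln r) / P))
    by (field; lra).
  exact (fs_u_deriv sys r Hr).
Qed.

Lemma euler_U r : 0 < r < rad -> euler U r (growth N delta v U r * U r).
Proof.
  intros Hr; unfold euler; rewrite growth_mult_U by exact Hr.
  replace (_ / r) with (exp ((N - 1) * ln r + delta * ln (v r))).
  { exact (fs_U_deriv sys r Hr). }
  replace (N * ln r + delta * ln (v r))
    with ((N - 1) * ln r + delta * ln (v r) + ln r) by ring.
  rewrite (exp_plus _ (ln r)), (exp_ln r) by lra; field; lra.
Qed.

Lemma euler_ln_u r : 0 < r < rad -> euler (fun s => ln (u s)) r (- slope N P u U r).
Proof.
  intros Hr; pose proof (u_pos r Hr) as Hu.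
  eapply euler_value; [apply euler_ln_comp; [exact Hu | exact (euler_u r Hr)] |].
  field; lra.
Qed.

Lemma euler_ln_U r : 0 < r < rad -> euler (fun s => ln (U s)) r (growth N delta v U r).
Proof.
  intros Hr; pose proof (U_pos r Hr) as HU.
  eapply euler_value; [apply euler_ln_comp; [exact HU | exact (euler_U r Hr)] |].
  field; lra.
Qed.

Lemma euler_slope r :
  0 < r < rad ->
  euler (slope N P u U) r
    (slope N P u U r * (slope N P u U r - decay N P + growth N delta v U r / P)).
Proof.
  intros Hr.
  apply (euler_ext
    (fun s => exp (/ P * ln (U s) + (- decay N P * ln s + -1 * ln (u s))))).
  { intros s; unfold slope; f_equal; field; lra. }
  eapply euler_value.
  - apply (euler_exp (fun s => / P * ln (U s) + (- decay N P * ln s + -1 * ln (u s)))).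
    apply euler_plus; [| apply euler_plus]; apply euler_scal;
      [apply euler_ln_U | apply euler_ln | apply euler_ln_u]; lra.
  - f_equal; [unfold slope; f_equal |]; field; lra.
Qed.

Lemma u_nonincreasing s t : 0 < s -> s <= t -> t < rad -> u t <= u s.
Proof.
  intros Hs Hst Ht.
  apply (euler_nonincreasing u (fun r => - (slope N P u U r * u r))); try lra.
  - intros r Hr; apply euler_u; lra.
  - intros r Hr.
    pose proof (slope_pos N P u U r); pose proof (u_pos r ltac:(lra)).
    pose proof (Rmult_lt_0_compat (slope N P u U r) (u r)); lra.
Qed.

Lemma U_nondecreasing s t : 0 < s -> s <= t -> t < rad -> U s <= U t.
Proof.
  intros Hs Hst Ht.
  apply (euler_nondecreasing U (fun r => growth N delta v U r * U r)); try lra.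
  - intros r Hr; apply euler_U; lra.
  - intros r Hr.
    pose proof (growth_pos N delta v U r); pose proof (U_pos r ltac:(lra)).
    pose proof (Rmult_lt_0_compat (growth N delta v U r) (U r)); lra.
Qed.

End Flow.

Section Bounds.

Context {N P Q delta mu rad : R} {u v U V : R -> R}.
Context (hN : 1 <= N) (hP : 0 < P) (hQ : 0 < Q) (hdelta : 0 < delta).
Context (sys : flux_system N P Q delta mu rad u v U V).

Let u_pos := fs_u_pos sys.
Let v_pos := fs_v_pos sys.
Let U_pos := fs_U_pos sys.

Lemma euler_growth r :
  0 < r < rad ->
  euler (growth N delta v U) r
    (growth N delta v U r * (N - delta * slope N Q v V r - growth N delta v U r)).
Proof.
  intros Hr.
  apply (euler_ext (fun s => exp (N * ln s + (delta * ln (v s) + -1 * ln (U s))))).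
  { intros s; unfold growth; f_equal; ring. }
  eapply euler_value.
  - apply (euler_exp (fun s => N * ln s + (delta * ln (v s) + -1 * ln (U s)))).
    apply euler_plus; [| apply euler_plus]; apply euler_scal;
      [apply euler_ln; lra | | apply (euler_ln_U sys); lra].
    exact (euler_ln_u hQ (flux_system_swap sys) r Hr).
  - f_equal; [unfold growth; f_equal |]; ring.
Qed.

(** Since v decreases, U(r) is at least the integral of s^(N-1) v(r)^delta over
    (0,r), which is r^N v(r)^delta / N. *)
Lemma growth_le_dim r : 0 < r < rad -> growth N delta v U r <= N.
Proof.
  intros Hr; apply Rnot_lt_le; intros Hlt.
  set (c := exp (delta * ln (v r))).
  assert (Hc : 0 < c) by apply exp_pos.
  set (G := fun s => N * U s + - c * exp (N * ln s)).
  assert (HG : G r < 0).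
  { unfold G; pose proof (growth_mult_U sys r Hr) as HZ.
    rewrite exp_plus in HZ; fold c in HZ.
    pose proof (Rmult_lt_compat_r (U r) _ _ (U_pos r Hr) Hlt); lra. }
  destruct (exists_small_ln r ((ln (- G r) - ln c) / N)) as [s [Hs Hsmall]]; [lra |].
  assert (Hmono : G s <= G r).
  { apply (euler_nondecreasing G (fun x => N * (growth N delta v U x * U x)
      + - c * (exp (N * ln x) * (N * 1)))); try lra.
    - intros x Hx; apply euler_plus; apply euler_scal;
        [apply (euler_U sys); lra |].
      apply (euler_exp (fun y => N * ln y)), euler_scal, euler_ln; lra.
    - intros x Hx; rewrite (growth_mult_U sys) by lra; rewrite exp_plus.
      assert (Hv : c <= exp (delta * ln (v x))).
      { apply exp_le, Rmult_le_compat_l, ln_le; try lra; [apply v_pos; lra |].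
        apply (u_nonincreasing hQ (flux_system_swap sys)); lra. }
      pose proof (exp_pos (N * ln x)).
      assert (0 <= N * exp (N * ln x) * (exp (delta * ln (v x)) - c)).
      { repeat apply Rmult_le_pos; lra. }
      lra. }
  assert (c * exp (N * ln s) < - G r).
  { rewrite <- (exp_ln c Hc), <- exp_plus, <- (exp_ln (- G r)) by lra.
    apply exp_increasing.
    assert (N * ln s < N * ((ln (- G r) - ln c) / N))
      by (apply Rmult_lt_compat_l; lra).
    replace (N * ((ln (- G r) - ln c) / N)) with (ln (- G r) - ln c) in H
      by (field; lra); lra. }
  pose proof (Rmult_lt_0_compat N (U s) ltac:(lra) (U_pos s ltac:(lra))).
  unfold G at 1 in Hmono; lra.
Qed.

(** Integrating |u'| = (r^(1-N) U)^(1/P) over (r,2r), where U is at least U(r),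
    bounds u(r) below by a multiple of r |u'(r)|. *)
Lemma slope_bounded r :
  0 < r < rad / 2 -> slope N P u U r <= exp ((N - 1) * ln 2 / P).
Proof.
  intros Hr.
  set (c := exp ((ln (U r) - (N - 1) * ln (2 * r)) / P)).
  assert (Hmono : u (2 * r) + c * (2 * r) <= u r + c * r).
  { apply (euler_nonincreasing (fun s => u s + c * s)
      (fun s => - (slope N P u U s * u s) + c * s)); try lra.
    - intros s Hs; apply euler_plus; [apply (euler_u hP sys); lra |].
      apply euler_scal; unfold euler; replace (s / s) with 1 by (field; lra).
      apply derivable_pt_lim_id.
    - intros s Hs; rewrite (slope_mult_u hP sys) by lra.
      assert (c <= exp ((ln (U s) - (N - 1) * ln s) / P)).
      { apply exp_le, Rmult_le_compat_r; [left; apply Rinv_0_lt_compat; lra |].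
        assert (ln (U r) <= ln (U s)).
        { apply ln_le; [apply U_pos; lra | apply (U_nondecreasing sys); lra]. }
        assert ((N - 1) * ln s <= (N - 1) * ln (2 * r)).
        { apply Rmult_le_compat_l; [lra | apply ln_le; lra]. }
        lra. }
      assert (c * s <= exp ((ln (U s) - (N - 1) * ln s) / P) * s)
        by (apply Rmult_le_compat_r; lra).
      lra. }
  pose proof (u_pos (2 * r) ltac:(lra)); pose proof (u_pos r ltac:(lra)).
  apply Rmult_le_reg_r with (u r); [lra |].
  rewrite (slope_mult_u hP sys) by lra.
  replace ((ln (U r) - (N - 1) * ln r) / P)
    with ((N - 1) * ln 2 / P + (ln (U r) - (N - 1) * ln (2 * r)) / P).
  - rewrite exp_plus; fold c; rewrite Rmult_assoc.
    apply Rmult_le_compat_l; [left; apply exp_pos | lra].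
  - rewrite ln_mult by lra; field; lra.
Qed.

Lemma slope_blows_up L :
  0 <= decay N P -> 0 < L -> 0 < rad ->
  exists s, 0 < s < rad /\ forall r, s < r < rad -> L <= slope N P u U r.
Proof.
  intros Hdecay HL Hrad.
  set (k := exp (ln (U (rad / 2)) / P - decay N P * ln rad)).
  destruct (fs_u_vanish sys (k / L)) as [s [Hs Hsmall]].
  { apply Rdiv_lt_0_compat; [apply exp_pos | lra]. }
  exists (Rmax s (rad / 2)).
  pose proof (Rmax_l s (rad / 2)); pose proof (Rmax_r s (rad / 2)).
  split; [split; [lra | apply Rmax_lub_lt; lra] |].
  intros r Hr; pose proof (u_pos r ltac:(lra)) as Hu.
  specialize (Hsmall r ltac:(lra)).
  apply Rmult_le_reg_r with (u r); [lra |].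
  assert (Hk : k <= slope N P u U r * u r).
  { unfold slope; rewrite <- (exp_ln (u r)) at 2 by lra; rewrite <- exp_plus.
    apply exp_le.
    assert (ln (U (rad / 2)) / P <= ln (U r) / P).
    { apply Rmult_le_compat_r; [left; apply Rinv_0_lt_compat; lra |].
      apply ln_le; [apply U_pos; lra | apply (U_nondecreasing sys); lra]. }
    assert (decay N P * ln r <= decay N P * ln rad)
      by (apply Rmult_le_compat_l; [lra | apply ln_le; lra]).
    lra. }
  assert (L * u r < L * (k / L)) by (apply Rmult_lt_compat_l; lra).
  replace (L * (k / L)) with k in H1 by (field; lra); lra.
Qed.

End Bounds.

(** * The Pohozaev-type energy *)

Section Energy.

Context {N P Q delta mu rad : R} {u v U V : R -> R}.
Context (hN : 1 <= N) (hP : 0 < P) (hQ : 0 < Q) (hdelta : 0 < delta) (hmu : 0 < mu).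
Context (sys : flux_system N P Q delta mu rad u v U V).
Context (a b theta : R).

Let X := slope N P u U.
Let Y := slope N Q v V.
Let Z := growth N delta v U.
Let W := growth N mu u V.

Definition energy_weight (r : R) : R :=
  exp (a * ln (U r) + (b * ln (V r) + - theta * ln r)).

(** For p = q = 2 and a = b = 1 this is the classical energy
    r^N (u'v' + v^(delta+1)/(delta+1) + u^(mu+1)/(mu+1))
    + N r^(N-1) (u'v/(delta+1) + uv'/(mu+1)), times r^(N-2-theta). *)
Definition energy (r : R) : R :=
  energy_weight r
  + (- / (delta + 1) * (energy_weight r * (N + - a * Z r) / Y r)
     + - / (mu + 1) * (energy_weight r * (N + - b * W r) / X r)).

Let X_pos r : 0 < X r := slope_pos N P u U r.
Let Y_pos r : 0 < Y r := slope_pos N Q v V r.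
Let Z_pos r : 0 < Z r := growth_pos N delta v U r.
Let W_pos r : 0 < W r := growth_pos N mu u V r.
Let weight_pos r : 0 < energy_weight r := exp_pos _.

Definition energy_rate (r : R) : R :=
  energy_weight r * (N / (delta + 1) + N / (mu + 1) - theta)
  + energy_weight r / Y r / (delta + 1)
    * ((a * Z r - N) * (decay N Q - theta + (b - / Q) * W r) - a * (1 - a) * (Z r * Z r))
  + energy_weight r / X r / (mu + 1)
    * ((b * W r - N) * (decay N P - theta + (a - / P) * Z r) - b * (1 - b) * (W r * W r)).

Lemma euler_energy_weight r :
  0 < r < rad ->
  euler energy_weight r (energy_weight r * (a * Z r + (b * W r + - theta * 1))).
Proof.
  intros Hr.
  apply (euler_exp (fun s => a * ln (U s) + (b * ln (V s) + - theta * ln s))).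
  apply euler_plus; [| apply euler_plus]; apply euler_scal.
  - exact (euler_ln_U sys r Hr).
  - exact (euler_ln_U (flux_system_swap sys) r Hr).
  - apply euler_ln; lra.
Qed.

Lemma euler_energy r : 0 < r < rad -> euler energy r (energy_rate r).
Proof.
  intros Hr.
  pose proof (X_pos r) as HX; pose proof (Y_pos r) as HY.
  assert (Hterm : forall (F G : R -> R) c k l m, G r <> 0 ->
    euler F r l -> euler G r m ->
    euler (fun s => c * (energy_weight s * (N + - k * F s) / G s)) r
      (c * ((energy_weight r * (a * Z r + (b * W r + - theta * 1)) * (N + - k * F r)
             + energy_weight r * (0 + - k * l)) * G r
            - m * (energy_weight r * (N + - k * F r))) / (G r * G r))).
  { intros F G c k l m HG HF Hm.
    eapply euler_value.
    - apply euler_scal.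
      apply (euler_div (fun s => energy_weight s * (N + - k * F s)) G); [exact HG | | exact Hm].
      apply (euler_mult energy_weight (fun s => N + - k * F s));
        [exact (euler_energy_weight r Hr) |].
      apply euler_plus; [apply euler_const | apply euler_scal; exact HF].
    - unfold Rdiv; ring. }
  eapply euler_value.
  - unfold energy.
    apply euler_plus; [exact (euler_energy_weight r Hr) |].
    apply euler_plus; apply Hterm; try lra.
    + exact (euler_growth hQ sys r Hr).
    + exact (euler_slope hQ (flux_system_swap sys) r Hr).
    + exact (euler_growth hP (flux_system_swap sys) r Hr).
    + exact (euler_slope hP sys r Hr).
  - unfold energy_rate; fold X Y Z W.
    field; lra.
Qed.

(** In the first bracket of the rate, a Z - N <= 0 because Z <= N, and the factor
    decay N Q - theta + (b - 1/Q) W is smallest at W = N, where the upper bound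
    on theta makes it nonnegative. The second bracket is symmetric. *)
Lemma energy_rate_nonpos r :
  0 < a <= 1 -> 0 < b <= 1 -> a <= / P -> b <= / Q ->
  N / (delta + 1) + N / (mu + 1) <= theta ->
  theta <= decay N Q + N * (b - / Q) -> theta <= decay N P + N * (a - / P) ->
  0 < r < rad -> energy_rate r <= 0.
Proof.
  intros Ha Hb HaP HbQ Hth1 Hth2 Hth3 Hr.
  pose proof (growth_le_dim hN hQ hdelta sys r Hr) as HZ.
  pose proof (growth_le_dim hN hP hmu (flux_system_swap sys) r Hr) as HW.
  fold Z in HZ; fold W in HW.
  pose proof (X_pos r); pose proof (Y_pos r).
  pose proof (Z_pos r); pose proof (W_pos r); pose proof (weight_pos r).
  assert (Hbracket : forall c z w k t, 0 < c <= 1 -> 0 < z <= N -> 0 < w <= N -> k <= 0 ->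
    0 <= t + N * k -> (c * z - N) * (t + k * w) - c * (1 - c) * (z * z) <= 0).
  { intros c z w k t Hc Hz Hw Hk Ht.
    assert (0 <= (N - c * z) * (t + k * w)).
    { apply Rmult_le_pos; [| nra].
      assert (c * z <= 1 * z) by (apply Rmult_le_compat_r; lra); lra. }
    assert (0 <= c * (1 - c) * (z * z)) by (apply Rmult_le_pos; nra).
    lra. }
  pose proof (Hbracket a (Z r) (W r) (b - / Q) (decay N Q - theta)) as HB1.
  pose proof (Hbracket b (W r) (Z r) (a - / P) (decay N P - theta)) as HB2.
  specialize (HB1 ltac:(lra) ltac:(lra) ltac:(lra) ltac:(lra) ltac:(lra)).
  specialize (HB2 ltac:(lra) ltac:(lra) ltac:(lra) ltac:(lra) ltac:(lra)).
  assert (Hq : forall x c, 0 < x -> 0 < c -> 0 < energy_weight r / x / (c + 1)).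
  { intros x c Hx Hc; repeat apply Rdiv_lt_0_compat; lra. }
  pose proof (Hq (Y r) delta ltac:(lra) hdelta) as HA.
  pose proof (Hq (X r) mu ltac:(lra) hmu) as HB.
  unfold energy_rate.
  pose proof (Rmult_le_compat_l _ _ _ (Rlt_le _ _ HA) HB1).
  pose proof (Rmult_le_compat_l _ _ _ (Rlt_le _ _ HB) HB2).
  assert (energy_weight r * (N / (delta + 1) + N / (mu + 1) - theta)
    <= energy_weight r * 0) by (apply Rmult_le_compat_l; lra).
  lra.
Qed.

Lemma energy_le_weight r :
  0 < a <= 1 -> 0 < b <= 1 -> 0 < r < rad -> energy r <= energy_weight r.
Proof.
  intros Ha Hb Hr.
  pose proof (growth_le_dim hN hQ hdelta sys r Hr) as HZ.
  pose proof (growth_le_dim hN hP hmu (flux_system_swap sys) r Hr) as HW.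
  fold Z in HZ; fold W in HW.
  pose proof (Z_pos r); pose proof (W_pos r).
  assert (Hterm : forall c z x k, 0 < c <= 1 -> 0 < z <= N -> 0 < x -> 0 < k ->
    0 <= / (k + 1) * (energy_weight r * (N + - c * z) / x)).
  { intros c z x k Hc Hz Hx Hk.
    apply Rmult_le_pos; [left; apply Rinv_0_lt_compat; lra |].
    apply Rmult_le_pos; [| left; apply Rinv_0_lt_compat; lra].
    apply Rmult_le_pos; [left; apply weight_pos |].
    assert (c * z <= 1 * z) by (apply Rmult_le_compat_r; lra); lra. }
  pose proof (Hterm a (Z r) (Y r) delta Ha ltac:(lra) (Y_pos r) hdelta).
  pose proof (Hterm b (W r) (X r) mu Hb ltac:(lra) (X_pos r) hmu).
  unfold energy; lra.
Qed.

(** At the boundary u and v vanish while the fluxes do not, so only the term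
    |u'| |v'| of the energy survives. *)
Lemma energy_pos_near_boundary :
  0 < rad -> 0 < a -> 0 < b -> 0 <= decay N P -> 0 <= decay N Q ->
  exists s, 0 < s < rad /\ forall r, s < r < rad -> 0 < energy r.
Proof.
  intros Hrad Ha Hb HdP HdQ.
  destruct (slope_blows_up hP sys (2 * N) HdP) as [s1 [Hs1 HX]]; try lra.
  destruct (slope_blows_up hQ (flux_system_swap sys) (2 * N) HdQ) as [s2 [Hs2 HY]];
    try lra.
  exists (Rmax s1 s2); pose proof (Rmax_l s1 s2); pose proof (Rmax_r s1 s2).
  split; [split; [lra | apply Rmax_lub_lt; lra] |].
  intros r Hr.
  specialize (HX r ltac:(lra)); specialize (HY r ltac:(lra)); fold X in HX; fold Y in HY.
  assert (Hterm : forall c z x k, 0 < c -> 0 < z -> 2 * N <= x -> 0 < k ->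
    / (k + 1) * (energy_weight r * (N + - c * z) / x) < energy_weight r * / 2).
  { intros c z x k Hc Hz Hx Hk.
    replace (/ (k + 1) * (energy_weight r * (N + - c * z) / x))
      with (energy_weight r * ((N + - c * z) / ((k + 1) * x))) by (field; lra).
    apply Rmult_lt_compat_l; [apply weight_pos |].
    apply Rmult_lt_reg_r with ((k + 1) * x); [apply Rmult_lt_0_compat; lra |].
    unfold Rdiv; rewrite Rmult_assoc, Rinv_l by nra.
    assert (0 < c * z) by (apply Rmult_lt_0_compat; lra).
    assert (0 < k * x) by (apply Rmult_lt_0_compat; lra).
    lra. }
  pose proof (Hterm a (Z r) (Y r) delta Ha (Z_pos r) HY hdelta).
  pose proof (Hterm b (W r) (X r) mu Hb (W_pos r) HX hmu).
  unfold energy; lra.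
Qed.

Lemma energy_bounded_below :
  0 < rad -> 0 <= decay N P -> 0 <= decay N Q ->
  0 < a <= 1 -> 0 < b <= 1 -> a <= / P -> b <= / Q ->
  N / (delta + 1) + N / (mu + 1) <= theta ->
  theta <= decay N Q + N * (b - / Q) -> theta <= decay N P + N * (a - / P) ->
  exists c s, 0 < c /\ 0 < s < rad /\ forall r, 0 < r <= s -> c <= energy r.
Proof.
  intros Hrad HdP HdQ Ha Hb HaP HbQ Hth1 Hth2 Hth3.
  destruct energy_pos_near_boundary as [s [Hs Hpos]]; try lra.
  set (t := (s + rad) / 2).
  exists (energy t), t.
  split; [apply Hpos; unfold t; lra | split; [unfold t; lra |]].
  intros r Hr; unfold t in *.
  apply (euler_nonincreasing energy energy_rate); try lra.
  - intros x Hx; apply euler_energy; lra.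
  - intros x Hx; apply energy_rate_nonpos; lra.
Qed.

End Energy.

(** * A priori bounds at the origin *)

Section Origin.

Context {N P Q delta mu rad gam xi : R} {u v U V : R -> R}.
Context (hN : 1 <= N) (hP : 0 < P) (hQ : 0 < Q) (hdelta : 0 < delta).
Context (hxi : delta * xi = P * gam + P + 1).
Context (sys : flux_system N P Q delta mu rad u v U V).

(** Taking logarithms in X <= 2^((N-1)/P) and Z <= N gives inequalities that are
    linear in ln u, ln v, ln U, ln V. The shifts by multiples of ln r, which
    come from the self-similar solution u ~ r^(-gam), v ~ r^(-xi), absorb the
    dependence on r. *)
Lemma scaled_log_relations r :
  0 < r < rad / 2 ->
  delta * (ln (v r) + xi * ln r) <= ln (U r) - P * (decay N P - gam) * ln r + ln N
  /\ ln (U r) - P * (decay N P - gam) * ln r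
     <= P * (ln (u r) + gam * ln r) + (N - 1) * ln 2.
Proof.
  intros Hr; split.
  - assert (H : N * ln r + delta * ln (v r) - ln (U r) <= ln N).
    { rewrite <- (ln_exp (N * ln r + delta * ln (v r) - ln (U r))).
      apply ln_le; [apply exp_pos |].
      apply (growth_le_dim hN hQ hdelta sys); lra. }
    replace (P * (decay N P - gam)) with (N - delta * xi)
      by (rewrite hxi; unfold decay; field; lra).
    lra.
  - assert (H : ln (U r) / P - decay N P * ln r - ln (u r) <= (N - 1) * ln 2 / P).
    { rewrite <- (ln_exp (ln (U r) / P - _ - _)), <- (ln_exp ((N - 1) * ln 2 / P)).
      apply ln_le; [apply exp_pos |].
      exact (slope_bounded hN hP sys r Hr). }
    apply (Rmult_le_compat_l P) in H; [| lra].
    replace (P * ((N - 1) * ln 2 / P)) with ((N - 1) * ln 2) in H by (field; lra).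
    replace (P * (ln (U r) / P - decay N P * ln r - ln (u r)))
      with (ln (U r) - P * decay N P * ln r - P * ln (u r)) in H by (field; lra).
    lra.
Qed.

End Origin.

Section OriginBounds.

Context {N P Q delta mu rad gam xi : R} {u v U V : R -> R}.
Context (hN : 1 <= N) (hP : 0 < P) (hQ : 0 < Q) (hdelta : 0 < delta) (hmu : 0 < mu).
Context (hD : P * Q < delta * mu).
Context (hxi : delta * xi = P * gam + P + 1) (hgam : mu * gam = Q * xi + Q + 1).
Context (sys : flux_system N P Q delta mu rad u v U V).

Let rel_u := scaled_log_relations hN hP hQ hdelta hxi sys.
Let rel_v := scaled_log_relations hN hQ hP hmu hgam (flux_system_swap sys).

(** Going once around the cycle of relations multiplies by delta mu / (P Q) > 1,
    which forces an upper bound. *)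
Lemma scaled_logs_upper :
  exists C, forall r, 0 < r < rad / 2 ->
    ln (u r) + gam * ln r <= C /\ ln (v r) + xi * ln r <= C /\
    ln (U r) - P * (decay N P - gam) * ln r <= C /\
    ln (V r) - Q * (decay N Q - xi) * ln r <= C.
Proof.
  set (k := ln N + (N - 1) * ln 2).
  assert (0 <= ln N) by (rewrite <- ln_1; apply ln_le; lra).
  assert (0 <= (N - 1) * ln 2).
  { apply Rmult_le_pos; [lra | rewrite <- ln_1; apply ln_le; lra]. }
  set (D := delta * mu - P * Q).
  set (Cu := 2 * k * (Q + delta) / D); set (Cv := 2 * k * (P + mu) / D).
  exists (Rmax (Rmax Cu Cv) (Rmax (P * Cu + k) (Q * Cv + k))).
  pose proof (Rmax_l (Rmax Cu Cv) (Rmax (P * Cu + k) (Q * Cv + k))) as m1.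
  pose proof (Rmax_r (Rmax Cu Cv) (Rmax (P * Cu + k) (Q * Cv + k))) as m2.
  pose proof (Rmax_l Cu Cv) as m3; pose proof (Rmax_r Cu Cv) as m4.
  pose proof (Rmax_l (P * Cu + k) (Q * Cv + k)) as m5.
  pose proof (Rmax_r (P * Cu + k) (Q * Cv + k)) as m6.
  intros r Hr.
  destruct (rel_u r Hr) as [h1 h3]; destruct (rel_v r Hr) as [h2 h4].
  set (lu := ln (u r) + gam * ln r) in *; set (lv := ln (v r) + xi * ln r) in *.
  set (lU := ln (U r) - P * (decay N P - gam) * ln r) in *.
  set (lV := ln (V r) - Q * (decay N Q - xi) * ln r) in *.
  assert (g1 : delta * lv <= P * lu + 2 * k) by (unfold k; lra).
  assert (g2 : mu * lu <= Q * lv + 2 * k) by (unfold k; lra).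
  assert (Hu : lu <= Cu).
  { apply Rmult_le_reg_l with D; [unfold D; lra |].
    replace (D * Cu) with (2 * k * (Q + delta)) by (unfold Cu; field; unfold D; lra).
    apply (Rmult_le_compat_l Q) in g1; [| lra].
    apply (Rmult_le_compat_l delta) in g2; [| lra].
    unfold D; lra. }
  assert (Hv : lv <= Cv).
  { apply Rmult_le_reg_l with D; [unfold D; lra |].
    replace (D * Cv) with (2 * k * (P + mu)) by (unfold Cv; field; unfold D; lra).
    apply (Rmult_le_compat_l mu) in g1; [| lra].
    apply (Rmult_le_compat_l P) in g2; [| lra].
    unfold D; lra. }
  assert (P * lu <= P * Cu) by (apply Rmult_le_compat_l; lra).
  assert (Q * lv <= Q * Cv) by (apply Rmult_le_compat_l; lra).
  unfold k in *; repeat split; lra.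
Qed.

Section Weights.

Context {a b theta : R}.
Context (hrad : 0 < rad) (hdP : 0 <= decay N P) (hdQ : 0 <= decay N Q).
Context (ha : 0 < a <= 1) (hb : 0 < b <= 1) (haP : a <= / P) (hbQ : b <= / Q).
Context (hsum : N / (delta + 1) + N / (mu + 1) <= theta).
Context (hthQ : theta <= decay N Q + N * (b - / Q)).
Context (hthP : theta <= decay N P + N * (a - / P)).

Let energy_low :=
  energy_bounded_below hN hP hQ hdelta hmu sys a b theta hrad hdP hdQ ha hb haP hbQ
    hsum hthQ hthP.

Lemma energy_weight_log_lower :
  exists c s, 0 < s < rad /\ forall r, 0 < r <= s ->
    c <= a * ln (U r) + b * ln (V r) - theta * ln r.
Proof.
  destruct energy_low as [c [s [Hc [Hs Hlow]]]].
  exists (ln c), s; split; [exact Hs |].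
  intros r Hr; specialize (Hlow r Hr).
  pose proof (energy_le_weight hN hP hQ hdelta hmu sys a b theta r ha hb ltac:(lra)).
  replace (a * ln (U r) + b * ln (V r) - theta * ln r)
    with (ln (energy_weight (U := U) (V := V) a b theta r))
    by (unfold energy_weight; rewrite ln_exp; ring).
  apply ln_le; lra.
Qed.

(** The energy stays above a positive constant, while the a priori bounds make
    its weight tend to 0. *)
Lemma no_flux_system_of_weight_decay :
  theta < a * (P * (decay N P - gam)) + b * (Q * (decay N Q - xi)) -> False.
Proof.
  intros Hstrict.
  destruct scaled_logs_upper as [C HC].
  destruct energy_weight_log_lower as [c [s [Hs Hlow]]].
  set (e := a * (P * (decay N P - gam)) + b * (Q * (decay N Q - xi)) - theta).
  assert (He : 0 < e) by (unfold e; lra).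
  destruct (exists_small_ln (Rmin s (rad / 2)) ((c - (a + b) * C) / e)) as [r [Hr Hln]].
  { apply Rmin_glb_lt; lra. }
  pose proof (Rmin_l s (rad / 2)); pose proof (Rmin_r s (rad / 2)).
  specialize (Hlow r ltac:(lra)); destruct (HC r ltac:(lra)) as [_ [_ [HU HV]]].
  apply (Rmult_le_compat_l a) in HU; [| lra].
  apply (Rmult_le_compat_l b) in HV; [| lra].
  apply (Rmult_lt_compat_l e) in Hln; [| lra].
  replace (e * ((c - (a + b) * C) / e)) with (c - (a + b) * C) in Hln by (field; lra).
  unfold e in Hln; lra.
Qed.

End Weights.

End OriginBounds.

(** * The critical semilinear case *)

(** The right-hand side is the derivative in ln r of the functional [virial]
    below, divided by its weight, after the positivity of the energy has
    eliminated Z and W. The exponents i, j of the weight and the constant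
    2 gam xi - 2 n gam xi / N are chosen so that, in the relative deviations of X
    from gam and of Y from xi, completing squares leaves a positive
    remainder. *)
Lemma virial_quadratic_lower gam xi X Y :
  0 < gam -> 0 < xi ->
  let n := gam + xi in
  let N := n + 2 in
  let i := - (N * (xi - gam) + 4 * gam) / (2 * n * gam) in
  let j := - (4 * xi - N * (xi - gam)) / (2 * n * xi) in
  gam * xi * (2 * (3 * n + 2) / ((n + 1) * (n + 2)))
  <= (i * (gam - X) + j * (xi - Y)) * (xi * X + gam * Y - (2 * gam * xi - 2 * n * gam * xi / N))
     + xi * X * (X - n) + gam * Y * (Y - n) + N * (xi * X + gam * Y) - N * (X * Y).
Proof.
  intros Hg Hx n N i j.
  set (m := (X / gam + Y / xi) / 2 - 1); set (e := (X / gam - Y / xi) / 2).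
  (* half the sum and half the difference of the relative deviations are m and e *)
  match goal with |- ?l <= ?r =>
    assert (E : r = l + gam * xi * (2 * ((m + n / N) * (m + n / N))
      + 2 * (n + 1) * ((e - (xi - gam) / (N * (n + 1))) * (e - (xi - gam) / (N * (n + 1))))
      + 8 * (gam * xi) / (N * N * (n + 1)))) end.
  { unfold i, j, m, e, N, n; field; repeat split; lra. }
  rewrite E.
  assert (Hn : 0 < n) by (unfold n; lra); assert (HN : 0 < N) by (unfold N; lra).
  assert (0 < gam * xi) by (apply Rmult_lt_0_compat; lra).
  assert (forall t, 0 <= t * t) by (intros t; apply Rle_0_sqr).
  match goal with |- ?l <= ?l + gam * xi * ?k => assert (0 <= k) end.
  { assert (0 <= 8 * (gam * xi) / (N * N * (n + 1))).
    { left; apply Rdiv_lt_0_compat; [lra |].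
      repeat apply Rmult_lt_0_compat; lra. }
    assert (0 <= 2 * (n + 1) * ((e - (xi - gam) / (N * (n + 1)))
      * (e - (xi - gam) / (N * (n + 1))))) by (apply Rmult_le_pos; [lra | auto]).
    specialize (H0 (m + n / N)); lra. }
  pose proof (Rmult_le_pos (gam * xi) _ (Rlt_le _ _ H) H1); lra.
Qed.

Section Critical.

Context {N delta mu rad : R} {u v U V : R -> R}.
Context (hN : 2 < N) (hdelta : 0 < delta) (hmu : 0 < mu) (hrad : 0 < rad).
Context (hcrit : N / (delta + 1) + N / (mu + 1) = N - 2).
Context (sys : flux_system N 1 1 delta mu rad u v U V).

Let xi := N / (delta + 1).
Let gam := N / (mu + 1).
Let X := slope N 1 u U.
Let Y := slope N 1 v V.
Let Z := growth N delta v U.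
Let W := growth N mu u V.

Let hsumrates : gam + xi = N - 2.
Proof. unfold gam, xi; lra. Qed.

Let xi_pos : 0 < xi.
Proof. unfold xi; apply Rdiv_lt_0_compat; lra. Qed.

Let gam_pos : 0 < gam.
Proof. unfold gam; apply Rdiv_lt_0_compat; lra. Qed.

Let hxi : delta * xi = 1 * gam + 1 + 1.
Proof.
  assert ((delta + 1) * xi = N) by (unfold xi; field; lra); lra.
Qed.

Let hgam : mu * gam = 1 * xi + 1 + 1.
Proof.
  assert ((mu + 1) * gam = N) by (unfold gam; field; lra); lra.
Qed.

Let hD : 1 * 1 < delta * mu.
Proof.
  (* (delta xi)(mu gam) = (gam + 2)(xi + 2) exceeds xi gam *)
  apply Rmult_lt_reg_r with (xi * gam); [apply Rmult_lt_0_compat; lra |].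
  replace (delta * mu * (xi * gam)) with ((delta * xi) * (mu * gam)) by ring.
  rewrite hxi, hgam; lra.
Qed.

Let decay_one : decay N 1 = N - 2.
Proof. unfold decay; field. Qed.

Let one_le_N : 1 <= N.
Proof. lra. Qed.

(** Here the weight of the energy is U V / r^(N-2), which is scale invariant: its
    lower bound turns the upper bounds on the rescaled fluxes into lower bounds,
    and u, v dominate their fluxes. *)
Lemma critical_scaled_logs_bounded :
  exists C s, 0 < s <= rad /\ forall r, 0 < r < s ->
    - C <= ln (u r) + gam * ln r <= C /\ - C <= ln (v r) + xi * ln r <= C.
Proof.
  destruct (scaled_logs_upper one_le_N Rlt_0_1 Rlt_0_1 hdelta hmu hD hxi hgam sys)
    as [C HC].
  destruct (energy_weight_log_lower one_le_N Rlt_0_1 Rlt_0_1 hdelta hmu sys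
    (a := 1) (b := 1) (theta := N - 2) hrad) as [c [s [Hs Hlow]]];
    try (rewrite ?decay_one; lra).
  exists (Rabs C + Rabs (c - C - (N - 1) * ln 2)), (Rmin s (rad / 2)).
  pose proof (Rmin_l s (rad / 2)); pose proof (Rmin_r s (rad / 2)).
  split; [split; [apply Rmin_glb_lt |]; lra |].
  intros r Hr.
  specialize (Hlow r ltac:(lra)); destruct (HC r ltac:(lra)) as [H1 [H2 [H3 H4]]].
  destruct (scaled_log_relations one_le_N Rlt_0_1 Rlt_0_1 hdelta hxi sys r
    ltac:(lra)) as [_ HU].
  destruct (scaled_log_relations one_le_N Rlt_0_1 Rlt_0_1 hmu hgam
    (flux_system_swap sys) r ltac:(lra)) as [_ HV].
  rewrite decay_one in *.
  pose proof (Rle_abs C); pose proof (Rabs_pos (c - C - (N - 1) * ln 2)).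
  pose proof (Rle_abs (- (c - C - (N - 1) * ln 2))) as Hneg; rewrite Rabs_Ropp in Hneg.
  pose proof (Rabs_pos C).
  assert (E : (gam + xi) * ln r = (N - 2) * ln r) by (rewrite hsumrates; reflexivity).
  lra.
Qed.

Let i := - (N * (xi - gam) + 4 * gam) / (2 * (gam + xi) * gam).
Let j := - (4 * xi - N * (xi - gam)) / (2 * (gam + xi) * xi).
Let L := 2 * gam * xi - 2 * (gam + xi) * gam * xi / N.

Definition virial_weight (r : R) : R :=
  exp (i * (ln (u r) + gam * ln r) + j * (ln (v r) + xi * ln r)).

Definition virial (r : R) : R :=
  virial_weight r * (xi * X r + (gam * Y r + - L)).

Lemma euler_virial r :
  0 < r < rad ->
  euler virial r (virial_weight r *
    ((i * (gam - X r) + j * (xi - Y r)) * (xi * X r + gam * Y r - L)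
     + xi * X r * (X r - (N - 2) + Z r) + gam * Y r * (Y r - (N - 2) + W r))).
Proof.
  intros Hr.
  assert (Hu := euler_ln_u Rlt_0_1 sys r Hr).
  assert (Hv := euler_ln_u Rlt_0_1 (flux_system_swap sys) r Hr).
  assert (Hln := euler_ln r ltac:(lra)).
  eapply euler_value.
  - apply (euler_mult virial_weight (fun s => xi * X s + (gam * Y s + - L))).
    + apply (euler_exp (fun s => i * (ln (u s) + gam * ln s) + j * (ln (v s) + xi * ln s))).
      apply euler_plus; apply euler_scal; apply euler_plus;
        [exact Hu | apply euler_scal; exact Hln | exact Hv | apply euler_scal; exact Hln].
    + apply euler_plus; [| apply euler_plus]; [apply euler_scal | apply euler_scal |].
      * exact (euler_slope Rlt_0_1 sys r Hr).
      * exact (euler_slope Rlt_0_1 (flux_system_swap sys) r Hr).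
      * apply euler_const.
  - fold (virial_weight r); fold X Y Z W; rewrite decay_one; field.
Qed.

Lemma virial_rate_lower r :
  0 < r < rad -> 0 < energy (N := N) (P := 1) (Q := 1) (delta := delta) (mu := mu)
    (u := u) (v := v) (U := U) (V := V) 1 1 (N - 2) r ->
  gam * xi * (2 * (3 * (N - 2) + 2) / ((N - 1) * N))
  <= (i * (gam - X r) + j * (xi - Y r)) * (xi * X r + gam * Y r - L)
     + xi * X r * (X r - (N - 2) + Z r) + gam * Y r * (Y r - (N - 2) + W r).
Proof.
  intros Hr HE.
  pose proof (virial_quadratic_lower gam xi (X r) (Y r) gam_pos xi_pos) as Hq.
  cbv zeta in Hq; replace (gam + xi + 2) with N in Hq by lra.
  fold i j L in Hq.
  replace (gam + xi + 1) with (N - 1) in Hq by lra.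
  rewrite hsumrates in Hq.
  enough (N * (xi * X r + gam * Y r) - N * (X r * Y r)
    <= xi * X r * Z r + gam * Y r * W r) by lra.
  assert (HX : 0 < X r) by apply slope_pos; assert (HY : 0 < Y r) by apply slope_pos.
  unfold energy in HE; fold X Y Z W in HE.
  set (h := energy_weight 1 1 (N - 2) r) in HE.
  assert (Hh : 0 < h) by apply exp_pos.
  assert (E : N * (X r * Y r) - xi * X r * (N - Z r) - gam * Y r * (N - W r)
    = (h + (- / (delta + 1) * (h * (N + - (1) * Z r) / Y r)
        + - / (mu + 1) * (h * (N + - (1) * W r) / X r))) * (N * X r * Y r / h)).
  { unfold xi, gam; field; repeat split; lra. }
  assert (0 < N * X r * Y r / h).
  { apply Rdiv_lt_0_compat; [| lra].
    repeat apply Rmult_lt_0_compat; lra. }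
  pose proof (Rmult_lt_0_compat _ _ HE H) as Hpos.
  rewrite <- E in Hpos; lra.
Qed.

(** In this case the energy is constant, so that its positivity alone is no
    contradiction. But r^gam u and r^xi v stay between positive constants, so the
    virial functional is bounded below, although its derivative in ln r is at
    least a positive constant. *)
Theorem no_flux_system_critical : False.
Proof.
  destruct critical_scaled_logs_bounded as [C [s [Hs HC]]].
  destruct (energy_bounded_below one_le_N Rlt_0_1 Rlt_0_1 hdelta hmu sys 1 1 (N - 2) hrad)
    as [c [t [Hc [Ht HE]]]]; try (rewrite ?decay_one; lra).
  set (B := (Rabs i + Rabs j) * C).
  set (rad' := Rmin s t).
  assert (Hrad' : 0 < rad') by (apply Rmin_glb_lt; lra).
  pose proof (Rmin_l s t) as Hl; pose proof (Rmin_r s t) as Hr'.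
  fold rad' in Hl, Hr'.
  assert (HM : forall r, 0 < r < rad' -> exp (- B) <= virial_weight r <= exp B).
  { intros r Hr; destruct (HC r ltac:(lra)) as [H1 H2].
    assert (Hb : forall k l, - C <= l <= C -> - (Rabs k * C) <= k * l <= Rabs k * C).
    { intros k l Hl'; apply Rabs_le in Hl'; pose proof (Rabs_pos k).
      assert (Rabs (k * l) <= Rabs k * C)
        by (rewrite Rabs_mult; apply Rmult_le_compat_l; lra).
      pose proof (Rle_abs (k * l)); pose proof (Rle_abs (- (k * l))) as Hn.
      rewrite Rabs_Ropp in Hn; lra. }
    pose proof (Hb i _ H1); pose proof (Hb j _ H2).
    unfold virial_weight, B; split; apply exp_le; lra. }
  set (eps := gam * xi * (2 * (3 * (N - 2) + 2) / ((N - 1) * N))).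
  assert (Heps : 0 < eps).
  { unfold eps; apply Rmult_lt_0_compat; [apply Rmult_lt_0_compat; lra |].
    apply Rdiv_lt_0_compat; [lra | apply Rmult_lt_0_compat; lra]. }
  destruct (euler_pos_unbounded virial (fun r => virial_weight r *
    ((i * (gam - X r) + j * (xi - Y r)) * (xi * X r + gam * Y r - L)
     + xi * X r * (X r - (N - 2) + Z r) + gam * Y r * (Y r - (N - 2) + W r)))
    rad' (exp (- B) * eps) (- (exp B * Rabs L))) as [r [Hr Hlow]]; auto.
  - apply Rmult_lt_0_compat; [apply exp_pos | exact Heps].
  - intros r Hr; apply euler_virial; lra.
  - intros r Hr; destruct (HM r Hr).
    apply Rmult_le_compat; [left; apply exp_pos | lra | lra |].
    apply virial_rate_lower; [lra |].
    specialize (HE r ltac:(lra)); lra.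
  - destruct (HM r Hr) as [_ HMr].
    assert (0 < virial_weight r) by apply exp_pos.
    pose proof (Rmult_lt_0_compat xi (X r) xi_pos (slope_pos _ _ _ _ _)).
    pose proof (Rmult_lt_0_compat gam (Y r) gam_pos (slope_pos _ _ _ _ _)).
    assert (virial_weight r * Rabs L <= exp B * Rabs L)
      by (apply Rmult_le_compat_r; [apply Rabs_pos | lra]).
    pose proof (Rle_abs L).
    assert (0 <= virial_weight r * (xi * X r + (gam * Y r + - L) + Rabs L))
      by (apply Rmult_le_pos; lra).
    unfold virial in Hlow; lra.
Qed.

End Critical.

(** * Nonexistence for the flux system *)

Lemma decay_antitone N P M : 1 <= N -> 0 < P -> P <= M -> decay N M <= decay N P.
Proof.
  intros HN HP HM; unfold decay, Rdiv.
  assert ((N - 1) * / M <= (N - 1) * / P)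
    by (apply Rmult_le_compat_l; [lra | apply Rinv_le_contravar; lra]).
  lra.
Qed.

Section Exponents.

Context {N P Q delta mu : R}.
Context (hN : 2 < N) (hP : 0 < P) (hQ : 0 < Q) (hdelta : 0 < delta) (hmu : 0 < mu).
Context (hD : P * Q < delta * mu).

(** The exponents of the self-similar solution r^(-gam), r^(-xi). *)
Lemma self_similar_exponents :
  exists gam xi, 0 < gam /\ 0 < xi /\
    delta * xi = P * gam + P + 1 /\ mu * gam = Q * xi + Q + 1.
Proof.
  assert (0 < P * Q) by (apply Rmult_lt_0_compat; lra).
  assert (0 < delta * Q) by (apply Rmult_lt_0_compat; lra).
  assert (0 < mu * P) by (apply Rmult_lt_0_compat; lra).
  exists ((Q * (P + 1) + delta * (Q + 1)) / (delta * mu - P * Q)),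
    ((P * (Q + 1) + mu * (P + 1)) / (delta * mu - P * Q)).
  repeat split; try (apply Rdiv_lt_0_compat; lra); field; lra.
Qed.

Context {gam xi : R} (hgam0 : 0 < gam) (hxi0 : 0 < xi).
Context (hxi : delta * xi = P * gam + P + 1) (hgam : mu * gam = Q * xi + Q + 1).

Let delta_rate : / (delta + 1) = xi / (P * gam + P + 1 + xi).
Proof.
  assert (0 < P * gam) by (apply Rmult_lt_0_compat; lra).
  replace (P * gam + P + 1 + xi) with ((delta + 1) * xi) by lra; field; lra.
Qed.

Let mu_rate : / (mu + 1) = gam / (Q * xi + Q + 1 + gam).
Proof.
  assert (0 < Q * xi) by (apply Rmult_lt_0_compat; lra).
  replace (Q * xi + Q + 1 + gam) with ((mu + 1) * gam) by lra; field; lra.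
Qed.

(** Replacing P and Q by M in 1/(delta+1) = xi / (P gam + P + 1 + xi) and in
    its counterpart for mu decreases both. With T = gam + xi the hypothesis then
    gives N T / (M T + M + 1) <= decay N M, that is T <= decay N M. *)
Lemma exponent_gap_degenerate M :
  1 <= M -> P <= M -> Q <= M ->
  N / (delta + 1) + N / (mu + 1) <= decay N M ->
  1 < M \/ N / (delta + 1) + N / (mu + 1) < decay N M ->
  gam + xi < decay N M.
Proof.
  intros HM HPM HQM Hle Hor.
  set (T := gam + xi); set (A := M * T + M + 1).
  assert (HA : 0 < A).
  { unfold A; assert (0 < M * T) by (apply Rmult_lt_0_compat; unfold T; lra); lra. }
  assert (Hcmp : forall K c d, 0 < K -> K <= M -> 0 < c -> 0 < d -> c + d = T ->
    c / A <= c / (K * d + K + 1 + c) /\ (1 < M -> c / A < c / (K * d + K + 1 + c))).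
  { intros K c d HK HKM Hc Hd HT.
    assert (0 < K * d) by (apply Rmult_lt_0_compat; lra).
    assert (K * d <= M * d) by (apply Rmult_le_compat_r; lra).
    assert (EA : A = M * d + M * c + M + 1) by (unfold A; rewrite <- HT; ring).
    split; intros; unfold Rdiv.
    - apply Rmult_le_compat_l; [lra |].
      apply Rinv_le_contravar; [lra |].
      assert (1 * c <= M * c) by (apply Rmult_le_compat_r; lra); lra.
    - apply Rmult_lt_compat_l; [lra |].
      apply Rinv_lt_contravar; [apply Rmult_lt_0_compat; lra |].
      assert (1 * c < M * c) by (apply Rmult_lt_compat_r; lra); lra. }
  destruct (Hcmp P xi gam hP HPM hxi0 hgam0 (Rplus_comm _ _)) as [Hx1 Hx2].
  destruct (Hcmp Q gam xi hQ HQM hgam0 hxi0 eq_refl) as [Hg1 Hg2].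
  rewrite <- delta_rate in Hx1, Hx2; rewrite <- mu_rate in Hg1, Hg2.
  assert (HT : N * (T / A) < decay N M).
  { replace (T / A) with (xi / A + gam / A) by (unfold T; field; lra).
    unfold Rdiv in Hle, Hor; unfold Rdiv in Hx1, Hx2, Hg1, Hg2.
    destruct Hor as [H1 | Hlt].
    - specialize (Hx2 H1); specialize (Hg2 H1).
      assert (N * (xi * / A) < N * / (delta + 1)) by (apply Rmult_lt_compat_l; lra).
      assert (N * (gam * / A) < N * / (mu + 1)) by (apply Rmult_lt_compat_l; lra).
      unfold Rdiv; lra.
    - assert (N * (xi * / A) <= N * / (delta + 1)) by (apply Rmult_le_compat_l; lra).
      assert (N * (gam * / A) <= N * / (mu + 1)) by (apply Rmult_le_compat_l; lra).
      unfold Rdiv; lra. }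
  apply (Rmult_lt_compat_r A) in HT; [| exact HA].
  replace (N * (T / A) * A) with (N * T) in HT by (field; lra).
  replace (decay N M * A) with ((N - 1 - M) * T + (M + 1) * decay N M) in HT
    by (unfold A, decay; field; lra).
  apply Rmult_lt_reg_l with (M + 1); [lra |]; lra.
Qed.

(** With x = P (gam + 1) and y = Q (xi + 1), the inequality P, Q <= 1 bounds the
    sum of the rates below by (x + y - 2)/(x + y), hence x + y by
    2 N / (1 + 1/M), and M <= 1 finishes. *)
Lemma exponent_gap_singular M :
  0 < M <= 1 -> P <= 1 -> Q <= 1 ->
  N / (delta + 1) + N / (mu + 1) <= N - 1 - / M ->
  M < 1 \/ N / (delta + 1) + N / (mu + 1) < N - 1 - / M ->
  P * (gam + 1) + Q * (xi + 1) < N - 1 + / M.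
Proof.
  intros HM HP1 HQ1 Hle Hor.
  set (x := P * (gam + 1)); set (y := Q * (xi + 1)).
  assert (Hx : 0 < x) by (apply Rmult_lt_0_compat; lra).
  assert (Hy : 0 < y) by (apply Rmult_lt_0_compat; lra).
  assert (Hcmp : forall c s t, 0 < c -> 0 < s -> 0 < t -> t - 1 <= c ->
    (t - 1) / (s + t) <= c / (s + 1 + c)).
  { intros c s t Hc Hs Ht Htc.
    apply Rmult_le_reg_r with ((s + t) * (s + 1 + c));
      [apply Rmult_lt_0_compat; lra |].
    replace ((t - 1) / (s + t) * ((s + t) * (s + 1 + c)))
      with ((t - 1) * (s + 1 + c)) by (field; lra).
    replace (c / (s + 1 + c) * ((s + t) * (s + 1 + c))) with (c * (s + t))
      by (field; lra).
    assert (0 <= (s + 1) * (c - (t - 1))) by (apply Rmult_le_pos; lra); lra. }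
  assert (Hyx : y - 1 <= xi).
  { assert (y <= 1 * (xi + 1)) by (apply Rmult_le_compat_r; lra); lra. }
  assert (Hxg : x - 1 <= gam).
  { assert (x <= 1 * (gam + 1)) by (apply Rmult_le_compat_r; lra); lra. }
  pose proof (Hcmp xi x y hxi0 Hx Hy Hyx) as H1.
  pose proof (Hcmp gam y x hgam0 Hy Hx Hxg) as H2.
  replace (x + 1 + xi) with (P * gam + P + 1 + xi) in H1 by (unfold x; ring).
  replace (y + 1 + gam) with (Q * xi + Q + 1 + gam) in H2 by (unfold y; ring).
  rewrite <- delta_rate in H1; rewrite <- mu_rate in H2.
  set (S := N / (delta + 1) + N / (mu + 1)) in *.
  assert (H3 : N * ((x + y - 2) / (x + y)) <= S).
  { replace ((x + y - 2) / (x + y)) with ((y - 1) / (x + y) + (x - 1) / (y + x))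
      by (field; lra).
    unfold S, Rdiv at 3 4; rewrite Rmult_plus_distr_l.
    apply Rplus_le_compat; apply Rmult_le_compat_l; lra. }
  apply (Rmult_le_compat_r (x + y)) in H3; [| lra].
  replace (N * ((x + y - 2) / (x + y)) * (x + y)) with (N * (x + y - 2)) in H3
    by (field; lra).
  set (g := / M) in *.
  assert (Hg : 1 <= g) by (unfold g; rewrite <- Rinv_1; apply Rinv_le_contravar; lra).
  assert (Hquad : 2 * N <= (1 + g) * (N - 1 + g)).
  { assert (0 <= (g - 1) * (N + g + 1)) by (apply Rmult_le_pos; lra); lra. }
  apply Rmult_lt_reg_l with (1 + g); [lra |].
  destruct Hor as [HM1 | Hlt].
  - assert (1 < g) by (unfold g; rewrite <- Rinv_1; apply Rinv_lt_contravar; lra).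
    assert (0 < (g - 1) * (N + g + 1)) by (apply Rmult_lt_0_compat; lra).
    assert (S * (x + y) <= (N - 1 - g) * (x + y)) by (apply Rmult_le_compat_r; lra).
    lra.
  - assert (S * (x + y) < (N - 1 - g) * (x + y)) by (apply Rmult_lt_compat_r; lra).
    lra.
Qed.

End Exponents.

(** With a = 1/P and b = 1/Q the upper bounds required of theta are
    theta <= decay N Q and theta <= decay N P, so the larger of P, Q decides. *)
Theorem no_flux_system_degenerate N P Q M delta mu rad u v U V :
  2 < N -> 0 < rad -> 0 < delta -> 0 < mu -> P * Q < delta * mu ->
  1 <= P <= M -> 1 <= Q <= M -> M < N - 1 ->
  N / (delta + 1) + N / (mu + 1) <= decay N M ->
  ~ flux_system N P Q delta mu rad u v U V.
Proof.
  intros hN hrad hdelta hmu hD hP hQ hM hsum sys.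
  assert (HdM : 0 <= decay N M).
  { unfold decay; assert (1 <= (N - 1) / M); [| lra].
    apply Rmult_le_reg_r with M; [lra |].
    replace ((N - 1) / M * M) with (N - 1) by (field; lra); lra. }
  pose proof (decay_antitone N P M ltac:(lra) ltac:(lra) ltac:(lra)).
  pose proof (decay_antitone N Q M ltac:(lra) ltac:(lra) ltac:(lra)).
  destruct (Rlt_dec 1 M) as [HM1 | HM1];
    [| destruct (Rlt_dec (N / (delta + 1) + N / (mu + 1)) (decay N M)) as [Hlt | Heq]].
  3: { assert (M = 1) by lra; assert (P = 1) by lra; assert (Q = 1) by lra; subst.
    apply (@no_flux_system_critical N delta mu rad u v U V); try assumption.
    unfold decay in *; lra. }
  all: assert (Hor : 1 < M \/ N / (delta + 1) + N / (mu + 1) < decay N M) by auto.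
  all: assert (hP0 : 0 < P) by lra; assert (hQ0 : 0 < Q) by lra.
  all: assert (hinv : forall K, 1 <= K -> 0 < / K <= 1)
    by (intros K HK; split; [apply Rinv_0_lt_compat; lra |
        rewrite <- Rinv_1; apply Rinv_le_contravar; lra]).
  all: destruct (self_similar_exponents hP0 hQ0 hdelta hmu hD)
    as [gam [xi [Hg0 [Hx0 [Hxi Hgam]]]]].
  all: pose proof (exponent_gap_degenerate hN hP0 hQ0 hdelta hmu Hg0 Hx0 Hxi Hgam M
    ltac:(lra) ltac:(lra) ltac:(lra) hsum Hor).
  all: apply (no_flux_system_of_weight_decay (a := / P) (b := / Q) (theta := decay N M)
    (N := N) (gam := gam) (xi := xi)
    ltac:(lra) hP0 hQ0 hdelta hmu hD Hxi Hgam sys hrad); try lra;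
    try (apply hinv; lra).
  all: replace (/ P * (P * (decay N P - gam))) with (decay N P - gam) by (field; lra);
    replace (/ Q * (Q * (decay N Q - xi))) with (decay N Q - xi) by (field; lra); lra.
Qed.

(** With a = b = 1 the upper bounds required of theta are theta <= N - 1 - 1/Q
    and theta <= N - 1 - 1/P, so the smaller of P, Q decides. *)
Theorem no_flux_system_singular N P Q M delta mu rad u v U V :
  2 < N -> 0 < rad -> 0 < delta -> 0 < mu -> P * Q < delta * mu ->
  0 < M -> M <= P <= 1 -> M <= Q <= 1 ->
  N / (delta + 1) + N / (mu + 1) <= N - 1 - / M ->
  ~ flux_system N P Q delta mu rad u v U V.
Proof.
  intros hN hrad hdelta hmu hD hM hP hQ hsum sys.
  assert (hP0 : 0 < P) by lra; assert (hQ0 : 0 < Q) by lra.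
  assert (hinv : forall K, M <= K <= 1 -> 1 <= / K <= / M).
  { intros K HK; split; [rewrite <- Rinv_1 |]; apply Rinv_le_contravar; lra. }
  pose proof (hinv P hP); pose proof (hinv Q hQ).
  assert (HdK : forall K, 0 < K <= 1 -> 0 <= decay N K).
  { intros K HK; pose proof (decay_antitone N K 1 ltac:(lra) ltac:(lra) ltac:(lra)).
    unfold decay in *; lra. }
  destruct (Rlt_dec M 1) as [HM1 | HM1];
    [| destruct (Rlt_dec (N / (delta + 1) + N / (mu + 1)) (N - 1 - / M)) as [Hlt | Heq]].
  3: { assert (M = 1) by lra; assert (P = 1) by lra; assert (Q = 1) by lra; subst.
    apply (@no_flux_system_critical N delta mu rad u v U V); try assumption.
    rewrite Rinv_1 in *; lra. }
  all: assert (Hor : M < 1 \/ N / (delta + 1) + N / (mu + 1) < N - 1 - / M) by auto.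
  all: destruct (self_similar_exponents hP0 hQ0 hdelta hmu hD)
    as [gam [xi [Hg0 [Hx0 [Hxi Hgam]]]]].
  all: pose proof (exponent_gap_singular hN hP0 hQ0 hdelta hmu Hg0 Hx0 Hxi Hgam M
    ltac:(lra) ltac:(lra) ltac:(lra) hsum Hor).
  all: assert (HdP : forall K, 0 < K -> decay N K + N * (1 - / K) = N - 1 - / K)
    by (intros K HK; unfold decay; field; lra).
  all: apply (no_flux_system_of_weight_decay (a := 1) (b := 1) (theta := N - 1 - / M)
    (N := N) (gam := gam) (xi := xi)
    ltac:(lra) hP0 hQ0 hdelta hmu hD Hxi Hgam sys hrad);
    rewrite ?HdP by lra; try lra; try (apply HdK; lra).
  all: replace (1 * (P * (decay N P - gam)) + 1 * (Q * (decay N Q - xi)))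
    with (2 * (N - 1) - (P * (gam + 1) + Q * (xi + 1))) by (unfold decay; field; lra);
    lra.
Qed.

(** * From radial solutions to fluxes *)

Lemma D_in_interior f f' rad x :
  0 < x < rad -> D_in f f' (half_open_interval rad) x -> derivable_pt_lim f x (f' x).
Proof.
  intros Hx HD eps Heps.
  destruct (HD eps Heps) as [al [Hal Hlim]].
  assert (Hpos : 0 < Rmin al (Rmin x (rad - x))) by (repeat apply Rmin_glb_lt; lra).
  exists (mkposreal _ Hpos); simpl; intros h Hh0 Hh.
  pose proof (Rmin_l al (Rmin x (rad - x))); pose proof (Rmin_r al (Rmin x (rad - x))).
  pose proof (Rmin_l x (rad - x)); pose proof (Rmin_r x (rad - x)).
  destruct (Rabs_def2 h _ Hh) as [Hh1 Hh2].
  specialize (Hlim (x + h)); simpl in Hlim; unfold Rdist in Hlim.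
  replace (x + h - x) with h in Hlim by ring.
  apply Hlim; split; [| lra].
  unfold D_x, half_open_interval; repeat split; lra.
Qed.

Lemma vanish_near_boundary f f' rad eps :
  0 < rad -> D_in f f' (half_open_interval rad) rad -> f rad = 0 -> 0 < eps ->
  exists s, 0 < s < rad /\ forall r, s < r < rad -> f r < eps.
Proof.
  intros Hrad HD Hf Heps.
  destruct (cont_deriv f f' _ rad HD eps Heps) as [al [Hal Hlim]].
  exists (Rmax (rad / 2) (rad - al)).
  pose proof (Rmax_l (rad / 2) (rad - al)); pose proof (Rmax_r (rad / 2) (rad - al)).
  split; [split; [lra | apply Rmax_lub_lt; lra] |].
  intros r Hr; specialize (Hlim r); simpl in Hlim; unfold Rdist in Hlim.
  rewrite Hf, Rminus_0_r in Hlim.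
  apply Rle_lt_trans with (Rabs (f r)); [apply Rle_abs |].
  apply Hlim; split.
  - unfold D_x, half_open_interval; repeat split; lra.
  - apply Rabs_def1; lra.
Qed.

Lemma pow_dim_exp N r :
  (0 < N)%nat -> 0 < r -> r ^ (N - 1) = exp ((INR N - 1) * ln r).
Proof.
  intros HN Hr; rewrite <- (Rpower_pow (N - 1) r Hr); unfold Rpower.
  rewrite minus_INR by lia; reflexivity.
Qed.

Lemma plap_flux_pos m s : 0 < s -> plap_flux m s = exp ((m - 1) * ln s).
Proof.
  intros Hs; unfold plap_flux, Rpower; rewrite Rabs_pos_eq by lra.
  rewrite <- (exp_ln s Hs) at 2; rewrite <- exp_plus; f_equal; ring.
Qed.

Lemma plap_flux_opp m s : plap_flux m (- s) = - plap_flux m s.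
Proof. unfold plap_flux; rewrite Rabs_Ropp; ring. Qed.

Lemma plap_flux_pos_inv m s : 0 < plap_flux m s -> 0 < s.
Proof.
  unfold plap_flux, Rpower; intros H; pose proof (exp_pos ((m - 2) * ln (Rabs s))).
  apply Rnot_le_lt; intros Hs.
  assert (0 <= exp ((m - 2) * ln (Rabs s)) * - s) by (apply Rmult_le_pos; lra).
  lra.
Qed.

Section Component.

Context {N : nat} {m rad : R} {w w' F rate : R -> R}.
Context (hN : (2 < N)%nat) (hm : 1 < m) (hdecay : 0 <= decay (INR N) (m - 1)).
Context (hw : forall r, 0 < r < rad -> derivable_pt_lim w r (w' r)).
Context (hpos : forall r, 0 < r < rad -> 0 < w r).
Context (hF : forall r, F r = - (r ^ (N - 1) * plap_flux m (w' r))).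
Context (hrate : forall r, 0 < r < rad -> derivable_pt_lim F r (rate r)).
Context (hrate_pos : forall r, 0 < r < rad -> 0 < rate r).

(** The flux increases. If it were nonpositive somewhere, then near the origin
    w' >= c r^(-(N-1)/(m-1)) with c > 0, and since (N-1)/(m-1) >= 1 the function w would
    tend to -oo at 0. *)
Lemma flux_positive r : 0 < r < rad -> 0 < F r.
Proof.
  intros Hr; apply Rnot_le_lt; intros HF.
  assert (Hincr : forall s t, 0 < s -> s < t -> t < rad -> F s < F t).
  { intros s t Hs Hst Ht.
    destruct (MVT_cor2 F rate s t Hst) as [c [Hc1 Hc2]];
      [intros c Hc; apply hrate; lra |].
    pose proof (Rmult_lt_0_compat _ (t - s) (hrate_pos c ltac:(lra)) ltac:(lra)); lra. }
  set (r1 := r / 2).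
  assert (Hk : F r1 < 0).
  { pose proof (Hincr r1 r ltac:(unfold r1; lra) ltac:(unfold r1; lra) ltac:(lra)); lra. }
  set (k := - F r1).
  assert (Hbig : forall s, 0 < s < r1 ->
    exp (ln k / (m - 1) - decay (INR N) (m - 1) * ln r1) <= s * w' s).
  { intros s Hs.
    assert (Hks : k < s ^ (N - 1) * plap_flux m (w' s)).
    { pose proof (Hincr s r1 ltac:(lra) ltac:(lra) ltac:(unfold r1; lra)).
      rewrite hF in H; unfold k; lra. }
    rewrite pow_dim_exp in Hks by (lia || lra).
    pose proof (exp_pos ((INR N - 1) * ln s)) as He.
    assert (Hw' : 0 < w' s).
    { apply (plap_flux_pos_inv m), Rmult_lt_reg_l with (exp ((INR N - 1) * ln s));
        [lra | unfold k in Hks; lra]. }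
    rewrite plap_flux_pos, <- exp_plus in Hks by exact Hw'.
    assert (Hln : ln k <= (INR N - 1) * ln s + (m - 1) * ln (w' s)).
    { rewrite <- (ln_exp (_ + _)); apply ln_le; [unfold k; lra | lra]. }
    rewrite <- (exp_ln (w' s) Hw'), <- (exp_ln s) at 1 by lra.
    rewrite <- exp_plus; apply exp_le.
    apply (Rmult_le_compat_l (/ (m - 1))) in Hln;
      [| left; apply Rinv_0_lt_compat; lra].
    replace (/ (m - 1) * ((INR N - 1) * ln s + (m - 1) * ln (w' s)))
      with (decay (INR N) (m - 1) * ln s + ln s + ln (w' s)) in Hln
      by (unfold decay; field; lra).
    assert (decay (INR N) (m - 1) * ln s <= decay (INR N) (m - 1) * ln r1)
      by (apply Rmult_le_compat_l; [lra | apply ln_le; lra]).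
    unfold Rdiv; lra. }
  destruct (euler_pos_unbounded w (fun s => s * w' s) r1
    (exp (ln k / (m - 1) - decay (INR N) (m - 1) * ln r1)) 0) as [s [Hs Hneg]].
  - unfold r1; lra.
  - apply exp_pos.
  - intros s Hs; unfold euler; replace (s * w' s / s) with (w' s) by (field; lra).
    apply hw; unfold r1 in Hs; lra.
  - exact Hbig.
  - pose proof (hpos s ltac:(unfold r1 in Hs; lra)); lra.
Qed.

Lemma derivative_of_flux r :
  0 < r < rad -> w' r = - exp ((ln (F r) - (INR N - 1) * ln r) / (m - 1)).
Proof.
  intros Hr; pose proof (flux_positive r Hr) as HFr.
  pose proof (hF r) as E; rewrite pow_dim_exp in E by (lia || lra).
  rewrite Ropp_mult_distr_r, <- plap_flux_opp in E.
  pose proof (exp_pos ((INR N - 1) * ln r)).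
  assert (Hneg : 0 < - w' r).
  { apply (plap_flux_pos_inv m), Rmult_lt_reg_l with (exp ((INR N - 1) * ln r)); lra. }
  rewrite plap_flux_pos, <- exp_plus in E by exact Hneg.
  rewrite E, ln_exp.
  replace (((INR N - 1) * ln r + (m - 1) * ln (- w' r) - (INR N - 1) * ln r) / (m - 1))
    with (ln (- w' r)) by (field; lra).
  rewrite exp_ln by exact Hneg; ring.
Qed.

End Component.

Lemma radial_solution_flux_system N p q delta mu rad u v :
  (2 < N)%nat -> 0 < rad -> 1 < p -> 1 < q ->
  0 <= decay (INR N) (p - 1) -> 0 <= decay (INR N) (q - 1) ->
  is_radial_solution N p q delta mu rad u v ->
  exists U V, flux_system (INR N) (p - 1) (q - 1) delta mu rad u v U V.
Proof.
  intros hN hrad hp hq hdp hdq [u' [u'' [v' [v'' [Hu [Hv [Hpos [Hu0 [Hv0 [Eu Ev]]]]]]]]]].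
  exists (fun r => - (r ^ (N - 1) * plap_flux p (u' r))),
    (fun r => - (r ^ (N - 1) * plap_flux q (v' r))).
  assert (Hin : forall r, 0 < r < rad -> half_open_interval rad r)
    by (intros r Hr; unfold half_open_interval; lra).
  assert (Hrad : half_open_interval rad rad) by (unfold half_open_interval; lra).
  assert (du : forall r, 0 < r < rad -> derivable_pt_lim u r (u' r))
    by (intros r Hr; apply (D_in_interior u u' rad); [lra | apply Hu, Hin, Hr]).
  assert (dv : forall r, 0 < r < rad -> derivable_pt_lim v r (v' r))
    by (intros r Hr; apply (D_in_interior v v' rad); [lra | apply Hv, Hin, Hr]).
  assert (pu : forall r, 0 < r < rad -> 0 < u r) by (intros r Hr; apply Hpos, Hr).
  assert (pv : forall r, 0 < r < rad -> 0 < v r) by (intros r Hr; apply Hpos, Hr).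
  assert (Hrate : forall (z : R -> R) c r, 0 < r < rad ->
    r ^ (N - 1) * Rpower (z r) c = exp ((INR N - 1) * ln r + c * ln (z r))).
  { intros z c r Hr; rewrite pow_dim_exp by (lia || lra).
    unfold Rpower; rewrite exp_plus; reflexivity. }
  assert (Hrate_pos : forall (z : R -> R) c r, 0 < r < rad ->
    0 < r ^ (N - 1) * Rpower (z r) c).
  { intros z c r Hr; rewrite Hrate by exact Hr; apply exp_pos. }
  constructor; try assumption.
  - apply (flux_positive hN hp hdp du pu (fun r => eq_refl) Eu (Hrate_pos v delta)).
  - apply (flux_positive hN hq hdq dv pv (fun r => eq_refl) Ev (Hrate_pos u mu)).
  - intros r Hr; rewrite <- (derivative_of_flux hN hp hdp du pu (fun r => eq_refl) Eu
      (Hrate_pos v delta) r Hr); apply du, Hr.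
  - intros r Hr; rewrite <- (derivative_of_flux hN hq hdq dv pv (fun r => eq_refl) Ev
      (Hrate_pos u mu) r Hr); apply dv, Hr.
  - intros r Hr; rewrite <- (Hrate v) by exact Hr; apply Eu, Hr.
  - intros r Hr; rewrite <- (Hrate u) by exact Hr; apply Ev, Hr.
  - intros eps Heps; apply (vanish_near_boundary u u'); try assumption; apply Hu, Hrad.
  - intros eps Heps; apply (vanish_near_boundary v v'); try assumption; apply Hv, Hrad.
Qed.

(** * The nonexistence theorem *)

Theorem theorem1p7 (N : nat) (rad p q delta mu : R)
    (hN : (2 < N)%nat) (hrad : 0 < rad) (hp : 1 < p) (hq : 1 < q)
    (hdelta : 0 < delta) (hmu : 0 < mu)
    (hD : delta * mu - (p - 1) * (q - 1) > 0) :
  (2 <= p < INR N -> 2 <= q < INR N ->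
   1 / (delta + 1) + 1 / (mu + 1)
     <= (INR N - Rmax p q) / (INR N * (Rmax p q - 1)) ->
   ~ exists u v : R -> R, is_radial_solution N p q delta mu rad u v)
  /\
  (INR N / (INR N - 1) < p <= 2 -> INR N / (INR N - 1) < q <= 2 ->
   1 / (delta + 1) + 1 / (mu + 1)
     <= (INR N * (Rmin p q - 1) - Rmin p q) / (INR N * (Rmin p q - 1)) ->
   ~ exists u v : R -> R, is_radial_solution N p q delta mu rad u v).
Proof.
  assert (HN : 2 < INR N) by (apply (lt_INR 2) in hN; simpl in hN; lra).
  assert (Hdecay : forall m, 1 < m <= INR N -> 0 <= decay (INR N) (m - 1)).
  { intros m Hm; pose proof (decay_antitone (INR N) (m - 1) (INR N - 1)
      ltac:(lra) ltac:(lra) ltac:(lra)) as H.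
    unfold decay in *; replace ((INR N - 1) / (INR N - 1)) with 1 in H by (field; lra).
    lra. }
  assert (Hsum : forall B, 1 / (delta + 1) + 1 / (mu + 1) <= B ->
    INR N / (delta + 1) + INR N / (mu + 1) <= INR N * B).
  { intros B HB; apply (Rmult_le_compat_l (INR N)) in HB; [| lra].
    unfold Rdiv in *; lra. }
  split; intros Hp Hq HS [u [v Hsol]]; apply Hsum in HS;
    destruct (radial_solution_flux_system N p q delta mu rad u v hN hrad hp hq
      (Hdecay p ltac:(lra)) (Hdecay q ltac:(lra)) Hsol) as [U [V sys]].
  - pose proof (Rmax_l p q); pose proof (Rmax_r p q).
    assert (Rmax p q < INR N) by (apply Rmax_lub_lt; lra).
    apply (no_flux_system_degenerate (INR N) (p - 1) (q - 1) (Rmax p q - 1)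
      delta mu rad u v U V); try lra; [| exact sys].
    replace (decay (INR N) (Rmax p q - 1))
      with (INR N * ((INR N - Rmax p q) / (INR N * (Rmax p q - 1))))
      by (unfold decay; field; lra).
    exact HS.
  - pose proof (Rmin_l p q); pose proof (Rmin_r p q).
    assert (1 < Rmin p q) by (apply Rmin_glb_lt; lra).
    apply (no_flux_system_singular (INR N) (p - 1) (q - 1) (Rmin p q - 1)
      delta mu rad u v U V); try lra; [| exact sys].
    replace (INR N - 1 - / (Rmin p q - 1))
      with (INR N * ((INR N * (Rmin p q - 1) - Rmin p q) / (INR N * (Rmin p q - 1))))
      by (field; lra).
    exact HS.
Qed.
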